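(* Let $\mathbf{O}$ be the classical Cayley algebra over the field $\mathbb{R}$ of real numbers, and let $U(\mathbf{O})$ be the Moufang loop of its invertible elements under multiplication. Then the Moufang loop $U(\mathbf{O})/\mathbb{R}^{\star}$ is simple.
   Context: The classical Cayley algebra $\mathbf{O}$ is the Cayley-Dickson algebra $\mathbf{C}(-1,-1,-1)$ over $\mathbb{R}$, i.e. the $8$-dimensional real division algebra of octonions; it is an alternative algebra with unit $1$. The set $U(\mathbf{O})$ of invertible elements equals $\mathbf{O}\setminus\{0\}$ and is a Moufang loop under multiplication. $\mathbb{R}^{\star}$ denotes the set of nonzero real numbers, regarded as the normal subloop $\mathbb{R}^{\star}\cdot 1$ of $U(\mathbf{O})$, and $U(\mathbf{O})/\mathbb{R}^{\star}$ is the quotient loop. A loop is a set with a binary operation having a two-sided identity element and such that for all $a,b$ the equations $ax=b$ and $ya=b$ are uniquely solvable; a Moufang loop is a loop satisfying the Moufang identities (e.g. $x(y(xz)) = ((xy)x)z$). A subloop is normal if it is the kernel of a loop homomorphism. A loop is simple if its only normal subloops are the trivial one consisting of the identity and the whole loop. *)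

(* Defs.v *)
From mathcomp Require Import all_boot all_order all_algebra.
From mathcomp Require Import boolp classical_sets reals.
From mathcomp Require Import ring.

Set Implicit Arguments.
Unset Strict Implicit.
Unset Printing Implicit Defensive.

Import Order.TTheory GRing.Theory Num.Theory.

Local Open Scope classical_set_scope.
Local Open Scope ring_scope.

Record loop := Loop {
  loop_sort :> Type;
  lmul : loop_sort -> loop_sort -> loop_sort;
  lone : loop_sort;
  lmul1x : forall x, lmul lone x = x;
  lmulx1 : forall x, lmul x lone = x;
  ldivl : forall a b, exists! x, lmul a x = b;
  ldivr : forall a b, exists! y, lmul y a = b }.

Definition moufang (L : loop) : Prop :=
  [/\ forall x y z : L, lmul x (lmul y (lmul x z)) = lmul (lmul (lmul x y) x) z,
      forall x y z : L, lmul (lmul (lmul z x) y) x = lmul z (lmul x (lmul y x))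
    & forall x y z : L, lmul (lmul x y) (lmul z x) = lmul (lmul x (lmul y z)) x].

Definition loop_hom (L M : loop) (f : L -> M) : Prop :=
  forall x y, f (lmul x y) = lmul (f x) (f y).

Definition loop_ker (L M : loop) (f : L -> M) : set L :=
  [set x | f x = lone M].

Definition normal_subloop (L : loop) (N : set L) : Prop :=
  exists (M : loop) (f : L -> M), loop_hom f /\ N = loop_ker f.

Definition simple_loop (L : loop) : Prop :=
  forall N : set L, normal_subloop N -> N = [set lone L] \/ N = setT.

Section LoopTheory.
Variable L : loop.
Implicit Types x y z : L.

Lemma lmul_injl x y z : lmul x y = lmul x z -> y = z.
Proof.
by move=> e; case: (ldivl x (lmul x z)) => t [_ u]; rewrite -(u y e) -(u z erefl).
Qed.

Lemma lmul_injr x y z : lmul y x = lmul z x -> y = z.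
Proof.
by move=> e; case: (ldivr x (lmul z x)) => t [_ u]; rewrite -(u y e) -(u z erefl).
Qed.
End LoopTheory.

Lemma loop_hom1 (L M : loop) (f : L -> M) : loop_hom f -> f (lone L) = lone M.
Proof.
by move=> hf; apply: (@lmul_injl M (f (lone L))); rewrite -hf !lmulx1.
Qed.

Section Cosets.
Variables (L : loop) (N : set L).

Definition coset (x : L) : set L := [set lmul x n | n in N].

Definition set_lmul (A B : set L) : set L :=
  [set z | exists x y, [/\ A x, B y & z = lmul x y]].

(* What is needed for the cosets to form a loop under multiplication of
   subsets; equivalent to normality by [normal_coset_loop] and
   [coset_loop_normal] below. *)
Record coset_loop_axioms : Prop := CosetLoopAxioms {
  coset_kerE : forall x, N x <-> coset x = coset (lone L);
  set_lmul_coset : forall x y,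
    set_lmul (coset x) (coset y) = coset (lmul x y);
  coset_injl : forall x y z,
    coset (lmul x y) = coset (lmul x z) -> coset y = coset z;
  coset_injr : forall x y z,
    coset (lmul y x) = coset (lmul z x) -> coset y = coset z }.

Definition coset_type := {A : set L | exists x, A = coset x}.

Definition to_coset (x : L) : coset_type :=
  exist _ (coset x) (ex_intro _ x erefl).

Lemma coset_type_inj (A B : coset_type) : sval A = sval B -> A = B.
Proof.
by case: A B => [A hA] [B hB] /= e; subst B; rewrite (Prop_irrelevance hA hB).
Qed.

Lemma to_cosetP (A : coset_type) : exists x, A = to_coset x.
Proof. by case: A => A [x e]; exists x; apply: coset_type_inj. Qed.

Hypothesis ax : coset_loop_axioms.

Lemma coset_mul_subproof (A B : coset_type) :
  exists x, set_lmul (sval A) (sval B) = coset x.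
Proof.
have [x ->] := svalP A; have [y ->] := svalP B; exists (lmul x y).
exact: set_lmul_coset.
Qed.

Definition coset_mul (A B : coset_type) : coset_type :=
  exist _ (set_lmul (sval A) (sval B)) (coset_mul_subproof A B).

Lemma coset_mulE x y :
  coset_mul (to_coset x) (to_coset y) = to_coset (lmul x y).
Proof. by apply: coset_type_inj; exact: set_lmul_coset. Qed.

Lemma coset_mul1x A : coset_mul (to_coset (lone L)) A = A.
Proof. by have [x ->] := to_cosetP A; rewrite coset_mulE lmul1x. Qed.

Lemma coset_mulx1 A : coset_mul A (to_coset (lone L)) = A.
Proof. by have [x ->] := to_cosetP A; rewrite coset_mulE lmulx1. Qed.

Lemma coset_divl A B : exists! X, coset_mul A X = B.
Proof.
have [a ->] := to_cosetP A; have [b ->] := to_cosetP B.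
have [x [<- _]] := ldivl a b; exists (to_coset x); split.
  exact: coset_mulE.
move=> Y; have [y ->] := to_cosetP Y; rewrite coset_mulE => /(congr1 sval) /= e.
by apply: coset_type_inj => /=; symmetry; apply: coset_injl e.
Qed.

Lemma coset_divr A B : exists! Y, coset_mul Y A = B.
Proof.
have [a ->] := to_cosetP A; have [b ->] := to_cosetP B.
have [x [<- _]] := ldivr a b; exists (to_coset x); split.
  exact: coset_mulE.
move=> Y; have [y ->] := to_cosetP Y; rewrite coset_mulE => /(congr1 sval) /= e.
by apply: coset_type_inj => /=; symmetry; apply: coset_injr e.
Qed.

Definition coset_loop : loop :=
  Loop coset_mul1x coset_mulx1 coset_divl coset_divr.

Lemma coset_loop_normal : normal_subloop N.
Proof.
exists coset_loop, to_coset; split=> [x y|]; first by rewrite /= coset_mulE.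
apply/seteqP; split=> x; rewrite /loop_ker /= => h.
  by apply: coset_type_inj => /=; apply/(coset_kerE ax).
by apply/(coset_kerE ax); exact: (congr1 sval h).
Qed.
End Cosets.

Lemma normal_coset_loop (L : loop) (N : set L) :
  normal_subloop N -> coset_loop_axioms N.
Proof.
case=> M [f [hf ->]].
have cE x : coset (loop_ker f) x = [set y | f y = f x].
  apply/seteqP; split=> y /=.
    by case=> n /= hn <-; rewrite hf hn lmulx1.
  move=> e; have [n [en _]] := ldivl x y; exists n => //=.
  by apply: (@lmul_injl _ (f x)); rewrite lmulx1 -hf en.
have cP x y : coset (loop_ker f) x = coset (loop_ker f) y <-> f x = f y.
  rewrite !cE; split=> [e|->] //.
  by have : [set z | f z = f x] x by []; rewrite e.
split.
- by move=> x; rewrite cP (loop_hom1 hf).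
- move=> x y; rewrite !cE; apply/seteqP; split=> z /=.
    by case=> u [v [/= hu hv ->]]; rewrite !hf hu hv.
  move=> e; have [w [ew _]] := ldivl x z; exists x, w; split => //=.
  by apply: (@lmul_injl _ (f x)); rewrite -!hf ew.
- by move=> x y z; rewrite !cP !hf; apply: lmul_injl.
- by move=> x y z; rewrite !cP !hf; apply: lmul_injr.
Qed.

(* The loop L / N of the cosets x N, multiplied as subsets of L. *)
Definition quotient_loop (L : loop) (N : set L) (hN : normal_subloop N) : loop :=
  coset_loop (normal_coset_loop hN).

(* Unital, not necessarily associative algebras with a conjugation; only the
   operations are recorded. *)
Record conj_alg (F : fieldType) := ConjAlg {
  ca_sort :> lmodType F;
  amul : ca_sort -> ca_sort -> ca_sort;
  aone : ca_sort;
  aconj : ca_sort -> ca_sort }.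

Definition base_alg (F : fieldType) : conj_alg F :=
  @ConjAlg F F^o (fun x y => (x : F) * (y : F)) (1 : F) id.

(* The double A + v A with v ^ 2 = mu, where (a, b) stands for a + v b:
   (a + v b) (c + v d) = (a c + mu d b~) + v (a~ d + c b)
   and (a + v b)~ = a~ - v b, with x~ the conjugate of x. *)
Definition cd_double (F : fieldType) (A : conj_alg F) (mu : F) : conj_alg F :=
  @ConjAlg F (A * A)%type
    (fun x y => (amul x.1 y.1 + mu *: amul y.2 (aconj x.2),
                 amul (aconj x.1) y.2 + amul y.1 x.2))
    (aone A, 0)
    (fun x => (aconj x.1, - x.2)).

(* Iterated doubling with v_1 ^ 2 = a, v_2 ^ 2 = b, v_3 ^ 2 = c; this is the
   convention for characteristic other than 2. *)
Definition cayley_dickson (F : fieldType) (a b c : F) : conj_alg F :=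
  cd_double (cd_double (cd_double (base_alg F) a) b) c.

Definition invertible (F : fieldType) (A : conj_alg F) (x : A) : Prop :=
  exists y : A, amul x y = aone A /\ amul y x = aone A.

Definition octonion (R : realType) : conj_alg R :=
  cayley_dickson (-1 : R) (-1) (-1).

Lemma addpE (R : pzRingType) (U V : lmodType R) (u u' : U) (v v' : V) :
  (u, v) + (u', v') = (u + u', v + v').
Proof. by []. Qed.

Lemma oppE (R : pzRingType) (U V : lmodType R) (u : U) (v : V) :
  - (u, v) = (- u, - v).
Proof. by []. Qed.

Lemma scalepE (R : pzRingType) (U V : lmodType R) (a : R) (u : U) (v : V) :
  a *: (u, v) = (a *: u, a *: v).
Proof. by []. Qed.

Lemma scaleoE (R : pzRingType) (a : R) (b : R^o) : a *: b = (a * b : R).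
Proof. by []. Qed.

Lemma scale_divr (F : fieldType) (V : lmodType F) (u v w : V) (a b : F) :
  a != 0 -> u = a *: v -> w = b *: v -> w = (b / a) *: u.
Proof. by move=> a0 -> ->; rewrite scalerA mulfVK. Qed.

Section OctonionUnits.
Variable R : realType.
Local Notation O := (octonion R).
Local Notation "x ** y" := (@amul _ O x y) (at level 40, left associativity).
Local Notation oct a0 a1 a2 a3 a4 a5 a6 a7 :=
  ((((a0, a1), (a2, a3)), ((a4, a5), (a6, a7))) : O).
Implicit Types (x y z : O) (a b : R).

(* Coordinate forms of the product, conjugation, scaling and norm, used to
   check polynomial identities with [ring]. *)
Definition omul x y : O :=
  let: (((a0, a1), (a2, a3)), ((a4, a5), (a6, a7))) := x in
  let: (((b0, b1), (b2, b3)), ((b4, b5), (b6, b7))) := y in oct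
    (a0 * b0 - a1 * b1 - a2 * b2 - a3 * b3 - a4 * b4 - a5 * b5 - a6 * b6 - a7 * b7)
    (a0 * b1 + a1 * b0 - a2 * b3 + a3 * b2 - a4 * b5 + a5 * b4 + a6 * b7 - a7 * b6)
    (a0 * b2 + a1 * b3 + a2 * b0 - a3 * b1 - a4 * b6 - a5 * b7 + a6 * b4 + a7 * b5)
    (a0 * b3 - a1 * b2 + a2 * b1 + a3 * b0 - a4 * b7 + a5 * b6 - a6 * b5 + a7 * b4)
    (a0 * b4 + a1 * b5 + a2 * b6 + a3 * b7 + a4 * b0 - a5 * b1 - a6 * b2 - a7 * b3)
    (a0 * b5 - a1 * b4 + a2 * b7 - a3 * b6 + a4 * b1 + a5 * b0 + a6 * b3 - a7 * b2)
    (a0 * b6 - a1 * b7 - a2 * b4 + a3 * b5 + a4 * b2 - a5 * b3 + a6 * b0 + a7 * b1)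
    (a0 * b7 + a1 * b6 - a2 * b5 - a3 * b4 + a4 * b3 + a5 * b2 - a6 * b1 + a7 * b0).

Definition oconj x : O :=
  let: (((a0, a1), (a2, a3)), ((a4, a5), (a6, a7))) := x in
  oct a0 (- a1) (- a2) (- a3) (- a4) (- a5) (- a6) (- a7).

Definition oscale a x : O :=
  let: (((a0, a1), (a2, a3)), ((a4, a5), (a6, a7))) := x in
  oct (a * a0) (a * a1) (a * a2) (a * a3) (a * a4) (a * a5) (a * a6) (a * a7).

Lemma amulE x y : x ** y = omul x y.
Proof.
move: x y => [[[a0 a1] [a2 a3]] [[a4 a5] [a6 a7]]].
move=> [[[b0 b1] [b2 b3]] [[b4 b5] [b6 b7]]].
rewrite /amul /= ?(oppE, scalepE, addpE, scaleoE).
by congr (((_, _), (_, _)), ((_, _), (_, _))); rewrite /=; ring.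
Qed.

Lemma aconjE x : aconj x = oconj x.
Proof.
move: x => [[[a0 a1] [a2 a3]] [[a4 a5] [a6 a7]]].
by rewrite /aconj /= ?(oppE, opprK).
Qed.

Lemma oscaleE a x : a *: x = oscale a x.
Proof. by move: x => [[[a0 a1] [a2 a3]] [[a4 a5] [a6 a7]]]. Qed.

Definition onorm x : R :=
  let: (((a0, a1), (a2, a3)), ((a4, a5), (a6, a7))) := x in
  (a0 ^+ 2 + a1 ^+ 2 + a2 ^+ 2 + a3 ^+ 2 + a4 ^+ 2 + a5 ^+ 2 + a6 ^+ 2 + a7 ^+ 2 : R).

Ltac oct_ring :=
  rewrite ?(aconjE, amulE, oscaleE) /omul /oconj /oscale /=;
  congr (((_, _), (_, _)), ((_, _), (_, _))); ring.

Lemma onormM x y : onorm (x ** y) = onorm x * onorm y.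
Proof.
move: x y => [[[a0 a1] [a2 a3]] [[a4 a5] [a6 a7]]].
move=> [[[b0 b1] [b2 b3]] [[b4 b5] [b6 b7]]].
by rewrite amulE /onorm /omul; ring.
Qed.

Lemma aconj_amul x y : aconj x ** (x ** y) = onorm x *: y.
Proof.
move: x y => [[[a0 a1] [a2 a3]] [[a4 a5] [a6 a7]]].
move=> [[[b0 b1] [b2 b3]] [[b4 b5] [b6 b7]]].
oct_ring.
Qed.

Lemma amul_aconj x y : (y ** x) ** aconj x = onorm x *: y.
Proof.
move: x y => [[[a0 a1] [a2 a3]] [[a4 a5] [a6 a7]]].
move=> [[[b0 b1] [b2 b3]] [[b4 b5] [b6 b7]]].
oct_ring.
Qed.

Arguments amul : simpl never.
Arguments aone : simpl never.
Arguments aconj : simpl never.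

Lemma amulZl a x y : (a *: x) ** y = a *: (x ** y).
Proof.
move: x y => [[[a0 a1] [a2 a3]] [[a4 a5] [a6 a7]]].
move=> [[[b0 b1] [b2 b3]] [[b4 b5] [b6 b7]]].
oct_ring.
Qed.

Lemma amulZr a x y : x ** (a *: y) = a *: (x ** y).
Proof.
move: x y => [[[a0 a1] [a2 a3]] [[a4 a5] [a6 a7]]].
move=> [[[b0 b1] [b2 b3]] [[b4 b5] [b6 b7]]].
oct_ring.
Qed.

Lemma aoneE : aone O = oct 1 0 0 0 0 0 0 0.
Proof. by []. Qed.

Lemma amul1x x : aone O ** x = x.
Proof. by move: x => [[[a0 a1] [a2 a3]] [[a4 a5] [a6 a7]]]; rewrite aoneE; oct_ring. Qed.

Lemma amulx1 x : x ** aone O = x.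
Proof. by move: x => [[[a0 a1] [a2 a3]] [[a4 a5] [a6 a7]]]; rewrite aoneE; oct_ring. Qed.

Lemma onorm1 : onorm (aone O) = 1.
Proof. by rewrite aoneE /onorm; ring. Qed.

Lemma onorm_conj x : onorm (aconj x) = onorm x.
Proof.
by move: x => [[[a0 a1] [a2 a3]] [[a4 a5] [a6 a7]]]; rewrite aconjE /onorm /oconj; ring.
Qed.

Lemma aconjK x : aconj (aconj x) = x.
Proof.
by move: x => [[[a0 a1] [a2 a3]] [[a4 a5] [a6 a7]]]; rewrite !aconjE /oconj !opprK.
Qed.

Lemma invertibleE x : invertible x <-> onorm x != 0.
Proof.
split=> [[y [e _]]|n0].
  apply: contra_eq_neq e => n0; apply/eqP => /(congr1 onorm).
  by rewrite onormM n0 mul0r onorm1 => /esym/eqP; rewrite oner_eq0.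
exists ((onorm x)^-1 *: aconj x); rewrite amulZl amulZr; split.
  have := aconj_amul (aconj x) (aone O); rewrite aconjK amulx1 onorm_conj => ->.
  by rewrite scalerA mulVf // scale1r.
have := aconj_amul x (aone O); rewrite amulx1 => ->.
by rewrite scalerA mulVf // scale1r.
Qed.

Lemma invertibleM x y : invertible x -> invertible y -> invertible (x ** y).
Proof. by rewrite !invertibleE onormM => nx ny; rewrite mulf_neq0. Qed.

Lemma invertible1 : invertible (aone O).
Proof. by rewrite invertibleE onorm1 oner_neq0. Qed.

Definition ounit := {x : O | invertible x}.

Lemma ounit_inj (u v : ounit) : sval u = sval v -> u = v.
Proof. by case: u v => [x hx] [y hy] /= e; apply: eq_exist.
Qed.

Definition ounit_mul (u v : ounit) : ounit :=
  exist _ (sval u ** sval v) (invertibleM (svalP u) (svalP v)).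

Definition ounit_one : ounit := exist _ (aone O) invertible1.

Lemma ounit_mul1x u : ounit_mul ounit_one u = u.
Proof. by apply: ounit_inj; rewrite /= amul1x. Qed.

Lemma ounit_mulx1 u : ounit_mul u ounit_one = u.
Proof. by apply: ounit_inj; rewrite /= amulx1. Qed.

Lemma ounit_divl u v : exists! w, ounit_mul u w = v.
Proof.
have nu := (invertibleE _).1 (svalP u).
have e : sval u ** ((onorm (sval u))^-1 *: (aconj (sval u) ** sval v)) = sval v.
  rewrite amulZr -{2}[sval u]aconjK aconj_amul onorm_conj.
  by rewrite scalerA mulVf // scale1r.
have h : invertible ((onorm (sval u))^-1 *: (aconj (sval u) ** sval v)).
  apply/invertibleE; apply/eqP => h.
  have /invertibleE := svalP v.
  by rewrite -{1}e onormM h mulr0 eqxx.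
exists (exist _ _ h); split; first exact: ounit_inj.
move=> w /(congr1 sval) /= ew; apply: ounit_inj => /=.
by rewrite -ew aconj_amul scalerA mulVf // scale1r.
Qed.

Lemma ounit_divr u v : exists! w, ounit_mul w u = v.
Proof.
have nu := (invertibleE _).1 (svalP u).
have e : ((onorm (sval u))^-1 *: (sval v ** aconj (sval u))) ** sval u = sval v.
  rewrite amulZl -{3}[sval u]aconjK amul_aconj onorm_conj.
  by rewrite scalerA mulVf // scale1r.
have h : invertible ((onorm (sval u))^-1 *: (sval v ** aconj (sval u))).
  apply/invertibleE; apply/eqP => h.
  have /invertibleE := svalP v.
  by rewrite -{1}e onormM h mul0r eqxx.
exists (exist _ _ h); split; first exact: ounit_inj.
move=> w /(congr1 sval) /= ew; apply: ounit_inj => /=.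
by rewrite -ew amul_aconj scalerA mulVf // scale1r.
Qed.

Definition ounit_loop : loop :=
  Loop ounit_mul1x ounit_mulx1 ounit_divl ounit_divr.

Definition real_units : set ounit_loop :=
  [set u | exists a : R, a != 0 /\ sval u = a *: aone O].

Lemma scalar_invertible a : a != 0 -> invertible (a *: aone O).
Proof.
move=> a0; exists (a^-1 *: aone O); split; rewrite amulZl amul1x scalerA.
  by rewrite mulfV // scale1r.
by rewrite mulVf // scale1r.
Qed.

Lemma coset_real_unitsP (u v : ounit_loop) :
  coset real_units u v <-> exists a : R, a != 0 /\ sval v = a *: sval u.
Proof.
split=> [[n [a [a0 e]] <-]|[a [a0 e]]].
  by exists a; rewrite /= e amulZr amulx1.
exists (exist _ _ (scalar_invertible a0) : ounit_loop); first by exists a.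
by apply: ounit_inj; rewrite /= amulZr amulx1.
Qed.

Lemma coset_real_units_eq (u v : ounit_loop) :
  coset real_units u = coset real_units v <->
  exists a : R, a != 0 /\ sval u = a *: sval v.
Proof.
split=> [e|[a [a0 e]]].
  by apply/coset_real_unitsP; rewrite -e; apply/coset_real_unitsP; exists 1;
     split; [exact: oner_neq0 | rewrite scale1r].
apply/seteqP; split=> w /coset_real_unitsP[b [b0 ew]]; apply/coset_real_unitsP.
  exists (b * a); split; first by rewrite mulf_neq0.
  by rewrite ew e -scalerA.
exists (b / a); split; first by rewrite mulf_neq0 ?invr_eq0.
exact: scale_divr a0 e ew.
Qed.

Lemma real_units_normal : normal_subloop real_units.
Proof.
apply: coset_loop_normal; split.
- move=> u; split=> [h|/coset_real_units_eq h]; last exact: h.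
  by apply/coset_real_units_eq; exact: h.
- move=> u v; apply/seteqP; split=> w.
    case=> [s [t [/coset_real_unitsP[a [a0 es]] /coset_real_unitsP[b [b0 et]] ->]]].
    apply/coset_real_unitsP; exists (a * b); split; first by rewrite mulf_neq0.
    by rewrite /= es et amulZl amulZr -scalerA.
  case=> n [a [a0 en]] <-; exists u, (lmul v n); split.
  + by apply/coset_real_unitsP; exists 1; split; [exact: oner_neq0 | rewrite scale1r].
  + by exists n => //; exists a.
  + by apply: ounit_inj; rewrite /= en amulZr amulx1 amulZr amulZr amulx1.
- move=> u v w /coset_real_units_eq[a [a0 /= e]]; apply/coset_real_units_eq.
  exists a; split; first exact: a0.
  have nu := (invertibleE _).1 (svalP u).
  apply: (scalerI nu); rewrite -aconj_amul e amulZr aconj_amul.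
  by rewrite !scalerA mulrC.
- move=> u v w /coset_real_units_eq[a [a0 /= e]]; apply/coset_real_units_eq.
  exists a; split; first exact: a0.
  have nu := (invertibleE _).1 (svalP u).
  apply: (scalerI nu); rewrite -amul_aconj e amulZl amul_aconj.
  by rewrite !scalerA mulrC.
Qed.

End OctonionUnits.

(* Main.v *)
Require Import Defs.
From mathcomp Require Import all_boot all_order all_algebra reals.
From mathcomp Require Import boolp classical_sets.
From mathcomp Require Import ring lra.

Set Implicit Arguments.
Unset Strict Implicit.
Unset Printing Implicit Defensive.

Import Order.TTheory GRing.Theory Num.Theory.

Local Open Scope ring_scope.

(** Let K be the kernel of a loop homomorphism on U(O) that kills the scalars.
If x and y have the same norm and the same real part, then a = x - y~ satisfies
x a = a y; so, among octonions of norm 1, membership in K depends only on the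
real part (when a = 0, y is the inverse of x). If c is the real part of a
unit octonion in K and |c| < 1, multiplying two such octonions with a variable
angle between their imaginary parts yields every real part in [2 c^2 - 1, 1].
We may take c >= 0, since -1 is in K; passing from c to 2 c^2 - 1 then at least
doubles 1 - c (while 2 c^2 - 1 > 0), so by the Archimedean property K contains
an octonion with real part 0, hence (c = 0) everything. *)

Arguments amul : simpl never.
Arguments aone : simpl never.
Arguments aconj : simpl never.

(** * Moufang identities, norm and conjugation in the octonions *)

Section OctonionIdentities.
Variable R : realType.
Local Notation O := (octonion R).
Local Notation "x ** y" := (@amul _ O x y) (at level 40, left associativity).
Local Notation oct a0 a1 a2 a3 a4 a5 a6 a7 :=
  ((((a0, a1), (a2, a3)), ((a4, a5), (a6, a7))) : O).
Implicit Types x y z : O.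

Definition ore x : R := x.1.1.1.

Ltac oct_destruct x := move: x => [[[? ?] [? ?]] [[? ?] [? ?]]].
Ltac oct_ring :=
  rewrite /omul /oconj; congr (((_, _), (_, _)), ((_, _), (_, _))); ring.

Lemma aconjM x y : aconj (x ** y) = aconj y ** aconj x.
Proof. by rewrite !(aconjE, amulE); oct_destruct x; oct_destruct y; oct_ring. Qed.

Lemma amul_moufangl x y z : x ** (y ** (x ** z)) = ((x ** y) ** x) ** z.
Proof.
rewrite !amulE; oct_destruct x; oct_destruct y; oct_destruct z; oct_ring.
Qed.

(** Conjugation is an injective anti-automorphism, so it turns this into the left Moufang
    identity. *)
Lemma amul_moufangr x y z : ((z ** x) ** y) ** x = z ** (x ** (y ** x)).
Proof.
apply: (can_inj (@aconjK R)).
rewrite [LHS]aconjM [in LHS]aconjM [in LHS]aconjM.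
rewrite [RHS]aconjM [in RHS]aconjM [in RHS]aconjM.
exact: amul_moufangl.
Qed.

Lemma amul_aconjr x : x ** aconj x = onorm x *: aone O.
Proof. by have := amul_aconj x (aone O); rewrite amul1x. Qed.

Lemma onormZ (a : R) x : onorm (a *: x) = a ^+ 2 * onorm x.
Proof. by oct_destruct x; rewrite oscaleE /onorm /oscale; ring. Qed.

Lemma onorm_ge0 x : 0 <= onorm x.
Proof. by oct_destruct x; rewrite /onorm !addr_ge0 ?sqr_ge0. Qed.

Lemma onorm_eq0 x : onorm x = 0 -> x = 0.
Proof.
oct_destruct x; rewrite /onorm => /eqP.
rewrite !paddr_eq0 ?addr_ge0 ?sqr_ge0 // !sqrf_eq0.
by do 7 case/andP; do 8 move=> /eqP ->.
Qed.

Lemma ore_sqr_le x : ore x ^+ 2 <= onorm x.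
Proof.
oct_destruct x; rewrite /onorm /ore /= -!addrA lerDl.
by rewrite !addr_ge0 ?sqr_ge0.
Qed.

(** The difference [onorm x - ore x ^+ 2] is the norm of the imaginary part. *)
Lemma ore_sqr_eq x : ore x ^+ 2 = onorm x -> x = ore x *: aone O.
Proof.
move=> e; have : onorm (x - ore x *: aone O) = 0.
  have -> : onorm (x - ore x *: aone O) = onorm x - ore x ^+ 2.
    clear e; oct_destruct x; rewrite aoneE oscaleE /oscale oppE !addpE /onorm /ore /=.
    by ring.
  by rewrite e subrr.
by move/onorm_eq0/eqP; rewrite subr_eq0 => /eqP.
Qed.

(* Both sides are multiplied on the right by the conjugate of z x. *)
Lemma amul_moufangm x y z : onorm (z ** x) != 0 ->
  (x ** y) ** (z ** x) = (x ** (y ** z)) ** x.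
Proof.
move=> n0.
have e : ((x ** (y ** z)) ** x) ** aconj (z ** x) = onorm (z ** x) *: (x ** y).
  rewrite aconjM -amul_moufangl -{2}[x]aconjK aconj_amul onorm_conj.
  rewrite !amulZr amul_aconj amulZr scalerA.
  by congr (_ *: _); rewrite onormM mulrC.
have := amul_aconj (aconj (z ** x)) ((x ** (y ** z)) ** x).
rewrite e aconjK onorm_conj amulZl; exact: scalerI n0 _ _.
Qed.

(** With [n] the common norm and [t] twice the common real part, [x ** x] is [t x - n] and the
    conjugate of [y] is [t - y]; hence both sides equal [x ** y - n]. *)
Lemma amul_conjugator x y : ore x = ore y -> onorm x = onorm y ->
  x ** (x - aconj y) = (x - aconj y) ** y.
Proof.
rewrite aconjE.
move: x y => [[[a0 a1] [a2 a3]] [[a4 a5] [a6 a7]]].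
move=> [[[b0 b1] [b2 b3]] [[b4 b5] [b6 b7]]].
rewrite /ore /onorm /= => -> en.
have -> : oct b0 a1 a2 a3 a4 a5 a6 a7
    - oct b0 (- b1) (- b2) (- b3) (- b4) (- b5) (- b6) (- b7)
  = oct (b0 - b0) (a1 - - b1) (a2 - - b2) (a3 - - b3) (a4 - - b4) (a5 - - b5)
        (a6 - - b6) (a7 - - b7) by [].
(* The equality of norms enters only in the real coordinate. *)
rewrite !amulE /omul; congr (((_, _), (_, _)), ((_, _), (_, _))); [lra | ring ..].
Qed.

End OctonionIdentities.

(** * Real parts of norm 1 elements of the kernel *)

Section KernelOfHom.
Variables (R : realType) (M : loop) (F : ounit_loop R -> M).
Hypotheses (FM : loop_hom F) (F_real : forall u, real_units u -> F u = lone M).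
Local Notation O := (octonion R).
Local Notation "x ** y" := (@amul _ O x y) (at level 40, left associativity).
Implicit Types (u v w : ounit_loop R) (a c t : R).

Lemma hom_scale u v a : a != 0 -> sval u = a *: sval v -> F u = F v.
Proof.
move=> a0 e; pose s : ounit_loop R := exist _ _ (scalar_invertible a0).
have -> : u = lmul v s by apply: ounit_inj; rewrite /= amulZr amulx1.
by rewrite FM (F_real (u := s)) ?lmulx1 //; exists a.
Qed.

Lemma hom_ore_eq u v : onorm (sval u) = 1 -> onorm (sval v) = 1 ->
  ore (sval u) = ore (sval v) -> F u = lone M -> F v = lone M.
Proof.
move=> nu nv er Fu; have [a0|a0] := eqVneq (onorm (sval u - aconj (sval v))) 0.
  move/onorm_eq0/eqP: a0; rewrite subr_eq0 => /eqP eu.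
  apply: (@lmul_injr _ (F u)); rewrite -FM lmul1x Fu.
  apply: F_real; exists 1; split; first exact: oner_neq0.
  by rewrite /= eu amul_aconjr nv.
pose w : ounit_loop R := exist _ _ ((invertibleE _).2 a0).
have /(congr1 F) : lmul u w = lmul w v.
  by apply: ounit_inj; rewrite /= amul_conjugator // nv.
rewrite !FM Fu lmul1x => e.
by apply: (@lmul_injl _ (F w)); rewrite lmulx1.
Qed.

(** By [hom_ore_eq], one such [u] puts every octonion of norm 1 and real part [c] in the kernel. *)
Definition ker_ore c : Prop :=
  exists u, [/\ F u = lone M, onorm (sval u) = 1 & ore (sval u) = c].

Lemma ker_oreN c : ker_ore c -> ker_ore (- c).
Proof.
case=> u [Fu nu eu].
have n1 : onorm (- sval u : O) = 1.
  by rewrite -scaleN1r onormZ nu sqrrN expr1n mulr1.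
have h : invertible (- sval u : O) by rewrite invertibleE n1 oner_neq0.
exists (exist _ _ h); split=> //=; last by rewrite -eu; case: (sval u) => [[[]]].
rewrite -Fu; apply: (@hom_scale _ _ (-1)); first by rewrite oppr_eq0 oner_neq0.
by rewrite scaleN1r.
Qed.

Lemma ker_ore_interval c t : ker_ore c -> c ^+ 2 < 1 ->
  2 * c ^+ 2 - 1 <= t <= 1 -> ker_ore t.
Proof.
case=> u [Fu nu eu] c1 /andP[tl tu].
have s0 : 0 < 1 - c ^+ 2 by rewrite subr_gt0.
pose s := Num.sqrt (1 - c ^+ 2).
have s2 : s ^+ 2 = 1 - c ^+ 2 by rewrite sqr_sqrtr // ltW.
(* [al] and [be] are the cosine and sine of the angle between the imaginary parts of [x] and [y]
   below. The real part of [x ** y] is [c ^+ 2 - s ^+ 2 * al]; setting it equal to [t] gives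
   [al]. *)
pose al := (c ^+ 2 - t) / (1 - c ^+ 2).
have als : s ^+ 2 * al = c ^+ 2 - t by rewrite s2 /al mulrC divfK ?gt_eqF.
have al1 : 0 <= 1 - al ^+ 2.
  have -> : 1 - al ^+ 2 = (1 - al) * (1 + al) by ring.
  (* The lower bound on [t] gives [al <= 1], the upper bound gives [-1 <= al]. *)
  apply: mulr_ge0.
    by rewrite subr_ge0 /al ler_pdivrMr // mul1r; lra.
  by rewrite -lerBlDl sub0r /al ler_pdivlMr // mulN1r; lra.
pose be := Num.sqrt (1 - al ^+ 2).
have be2 : be ^+ 2 = 1 - al ^+ 2 by rewrite sqr_sqrtr.
pose x : O := (((c, s), (0, 0)), ((0, 0), (0, 0))).
pose y : O := (((c, s * al), (s * be, 0)), ((0, 0), (0, 0))).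
have nx : onorm x = 1 by rewrite /onorm /x s2 /=; ring.
have ny : onorm y = 1.
  by rewrite /onorm /y ![(s * _) ^+ 2]exprMn be2 s2 /=; ring.
have ux : invertible x by rewrite invertibleE nx oner_neq0.
have uy : invertible y by rewrite invertibleE ny oner_neq0.
pose X : ounit_loop R := exist _ _ ux; pose Y : ounit_loop R := exist _ _ uy.
have FX : F X = lone M by apply: hom_ore_eq Fu.
have FY : F Y = lone M by apply: hom_ore_eq Fu.
have exy : sval (lmul X Y) = x ** y by [].
exists (lmul X Y); split; first by rewrite FM FX FY lmulx1.
  by rewrite exy onormM nx ny mulr1.
rewrite exy amulE /ore /=.
transitivity (c ^+ 2 - s ^+ 2 * al); first by ring.
by rewrite als; ring.
Qed.

Lemma ker_ore0 c : ker_ore c -> c ^+ 2 < 1 -> ker_ore 0.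
Proof.
move=> kc c1; wlog c0 : c kc c1 / 0 <= c.
  move=> IH; have [|/ltW c0] := leP 0 c; first exact: IH.
  by apply: (IH (- c)); rewrite ?sqrrN ?oppr_ge0 //; exact: ker_oreN.
have c1' : 0 < 1 - c by rewrite subr_gt0 -(@ltr_sqr _ c 1) ?nnegrE // expr1n.
(* [n] bounds the number of doublings of [1 - c], and drives the induction. *)
have [n hn] : exists n, 1 <= 2 ^+ n * (1 - c).
  exists (Num.bound (1 - c)^-1); rewrite -ler_pdivrMr // mul1r.
  apply: ltW; apply: lt_le_trans (archi_boundP _) _; first by rewrite invr_ge0 ltW.
  by rewrite -natrX ler_nat ltnW // ltn_expl.
elim: n => [|n IHn] in c kc c1 c0 c1' hn *.
  suff <- : c = 0 by [].
  by apply/le_anti; rewrite c0 andbT; move: hn; rewrite expr0 mul1r; lra.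
have [d0|d0] := leP (2 * c ^+ 2 - 1) 0.
  by apply: (ker_ore_interval kc c1); rewrite d0 ler01.
apply: (IHn (2 * c ^+ 2 - 1)).
- by apply: (ker_ore_interval kc c1); rewrite lexx /=; lra.
- by nra.
- exact: ltW.
- by lra.
(* Here [1 - (2 * c ^+ 2 - 1)] is [2 * (1 - c) * (1 + c)], at least [2 * (1 - c)] as [0 <= c]. *)
- apply: le_trans hn _; rewrite exprSr -mulrA ler_pM2l ?exprn_gt0 //.
  by nra.
Qed.

Lemma ounit_normalize u : exists v, [/\ onorm (sval v) = 1, F v = F u &
  exists a, a != 0 /\ sval v = a *: sval u].
Proof.
have n0 : 0 < onorm (sval u).
  by rewrite lt0r onorm_ge0 andbT; exact: (invertibleE _).1 (svalP u).
pose a := (Num.sqrt (onorm (sval u)))^-1.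
have a0 : a != 0 by rewrite invr_eq0 sqrtr_eq0 -ltNge.
have na : onorm (a *: sval u) = 1.
  by rewrite onormZ exprVn sqr_sqrtr ?mulVf ?gt_eqF // ltW.
have h : invertible (a *: sval u) by rewrite invertibleE na oner_neq0.
exists (exist _ _ h); split=> //; last by exists a.
exact: (hom_scale a0).
Qed.

Lemma hom_trivial u : F u = lone M -> ~ real_units u -> forall v, F v = lone M.
Proof.
move=> Fu nru v.
have [u' [nu' Fu' [a [a0 eu']]]] := ounit_normalize u.
have [v' [nv' <- _]] := ounit_normalize v.
have k0 : ker_ore 0.
  apply: (@ker_ore0 (ore (sval u'))); first by exists u'; rewrite Fu' Fu.
  (* A real part of square 1 would make [u'], and hence [u], a scalar. *)
  rewrite lt_neqAle -nu' ore_sqr_le andbT; apply/eqP => e; apply: nru.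
  have u'E := ore_sqr_eq e.
  exists (a^-1 * ore (sval u')); split.
    by rewrite mulf_neq0 ?invr_eq0 // -sqrf_eq0 e nu' oner_neq0.
  rewrite -scalerA (canRL (scalerK a0) (esym eu')).
  exact: (congr1 ( *:%R a^-1) u'E).
(* For [c = 0] the interval is [[-1, 1]], which contains the real part of any octonion of norm 1. *)
have [w [Fw nw ew]] : ker_ore (ore (sval v')).
  apply: (ker_ore_interval k0); first by rewrite expr0n ltr01.
  rewrite expr0n mulr0 sub0r -ler_norml.
  rewrite -(@ler_sqr _ `|_| 1) ?nnegrE // expr1n real_normK ?num_real //.
  by rewrite -nv' ore_sqr_le.
exact: hom_ore_eq nw nv' ew Fw.
Qed.

End KernelOfHom.

(** * Passage to the quotient loop *)

Lemma quotient_ounit_moufang (R : realType) :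
  moufang (quotient_loop (@real_units_normal R)).
Proof.
split=> A B C; have [x ->] := to_cosetP A; have [y ->] := to_cosetP B;
  have [z ->] := to_cosetP C; rewrite /= !coset_mulE; congr to_coset;
  apply: ounit_inj => /=.
- exact: amul_moufangl.
- exact: amul_moufangr.
- by apply: amul_moufangm; exact: (invertibleE _).1 (svalP (lmul z x)).
Qed.

Lemma quotient_ounit_simple (R : realType) :
  simple_loop (quotient_loop (@real_units_normal R)).
Proof.
move=> N [M [f [fM ->]]].
(* Pulling [f] back to the units gives a homomorphism that kills the scalars. *)
pose F (u : ounit_loop R) := f (to_coset (@real_units R) u).
have FM : loop_hom F.
  by move=> u v; rewrite /F -fM /= coset_mulE.
have ax := normal_coset_loop (@real_units_normal R).
have cosetE u : real_units u -> to_coset (@real_units R) u = to_coset _ (lone _).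
  by move=> h; apply: coset_type_inj; apply/(coset_kerE ax).
have F_real u : real_units u -> F u = lone M.
  by move=> /cosetE; rewrite /F => ->; exact: (loop_hom1 fM).
(* Either the kernel of [F] is just the scalars and [N] is trivial, or it contains a non-scalar and
   [hom_trivial] makes [N] everything. *)
have [triv|/existsNP[u /not_implyP[Fu nu]]] :=
  pselect (forall u, F u = lone M -> real_units u).
  left; apply/seteqP; split=> A /=; last by move->; exact: (loop_hom1 fM).
  by have [u ->] := to_cosetP A => /triv /cosetE.
right; apply/seteqP; split=> // A _; have [v ->] := to_cosetP A.
exact: (hom_trivial FM F_real Fu nu).
Qed.

Theorem mainTheorem3 (R : realType) :
  moufang (quotient_loop (@real_units_normal R)) /\
  simple_loop (quotient_loop (@real_units_normal R)).
Proof.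
split; [exact: quotient_ounit_moufang | exact: quotient_ounit_simple].
Qed.
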